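(* Let $\mathcal{C}$ be an exact-repair regenerating code with parameters $\{(n,k,d),(\alpha,\beta),B\}$, $n\ge d+1$, $k\ge 3$, where $\alpha=(d-p+1)\beta-\theta$ with $p\in\{1,\dots,k\}$, $\theta\in[0,\beta)$ ($\theta=0$ if $p=k$). Define, for $p\in\{2,\dots,k-1\}$, with $q_0=\lfloor (k-p+1)/p\rfloor$, $$\epsilon_0=\begin{cases}\dfrac{(d-k+1)(k-p)(\beta-\theta)-\theta}{(d-k+1)(k-p+1)+1}, & k-p+1<p,\\[2ex] \dfrac{\left(d-\frac{p(q_0+3)}{2}+2\right)q_0(p-1)(\beta-\theta)-\theta}{\left(d-\frac{p(q_0+3)}{2}+2\right)q_0p+1}, & k-p+1\ge p,\end{cases}$$ and, for $p\in\{1,\dots,k-2\}$, with $q_1=\lfloor (k-p)/(p+1)\rfloor$, $$\epsilon_1=\begin{cases}\dfrac{(d-k+1)\left[(k-p-2)\beta+\theta\right]}{(d-k+1)(k-p)+1}, & k-p<p+1,\\[2ex] \dfrac{\left(d-\frac{(p+1)(q_1+3)}{2}+2\right)q_1\left[(p-1)\beta+\theta\right]}{\left(d-\frac{(p+1)(q_1+3)}{2}+2\right)q_1(p+1)+1}, & k-p\ge p+1.\end{cases}$$ Then: (1) if $p=1$ and $\theta\ne0$, then $B\le\hat B-\epsilon_1$; (2) if $p\in\{2,3,\dots,k-2\}$, then $B\le\hat B-\max\{\epsilon_0,\epsilon_1\}$; (3) if $p=k-1$ and $\theta<\frac{d-k+1}{d-k+2}\beta$, then $B\le\hat B-\ep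silon_0$.
   Context: Setting: fix integers $k\le d<n$, a finite field $\mathbb{F}_q$, and reals $\alpha,\beta>0$. An exact-repair regenerating code with parameters $\{(n,k,d),(\alpha,\beta),B\}$: a file $M$ uniformly distributed over $\mathbb{F}_q^B$ (entropies measured in units of $\log q$); node $i\in[n]$ stores $W_i$, a deterministic function of $M$, with $H(W_i)\le\alpha$; (data collection) for every $K\subseteq[n]$ with $|K|=k$, $M$ is a function of $(W_a)_{a\in K}$; (exact repair) for every node $y$ and every set $D\subseteq[n]\setminus\{y\}$ with $|D|=d$, each $x\in D$ sends helper data (depending on $y$ and $D$), a deterministic function of $W_x$ of entropy at most $\beta$, from which $W_y$ is exactly recoverable. Notation $[i]=\{1,\dots,i\}$. The functional-repair optimal file size (cut-set bound) is $\hat B=\sum_{i=1}^k\min\{\alpha,(d-i+1)\beta\}=p\alpha+\sum_{i=p+1}^k(d-i+1)\beta$. *)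

(* Defs.v *)
From mathcomp Require Import all_boot all_algebra.
From Stdlib Require Import Reals.

Set Implicit Arguments.
Unset Strict Implicit.
Unset Printing Implicit Defensive.

Definition Rsum_seq {A : Type} (s : seq A) (g : A -> R) : R :=
  foldr (fun a acc => (g a + acc)%R) 0%R s.

(* Entropy (in units of log q) of f(M), M uniform on the finite type T:
   H(f(M)) = sum_m P(m) * log_q (1 / P(f M = f m)). *)
Definition entropy (q : nat) {T : finType} {V : eqType} (f : T -> V) : R :=
  Rsum_seq (enum T) (fun m =>
    (/ INR #|T| * (ln (INR #|T| / INR #|[pred m' | f m' == f m]|) / ln (INR q)))%R).

Definition msg (F : finFieldType) (B : nat) := (B.-tuple F)%type.

(* Exact-repair regenerating code: node contents W i : F_q^B -> nat
   (deterministic functions of the file, values encoded as naturals). *)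
Definition is_ER_code (F : finFieldType) (n k d B : nat) (alpha beta : R)
    (W : 'I_n -> msg F B -> nat) : Prop :=
  (forall i : 'I_n, (entropy #|F| (W i) <= alpha)%R) /\
  (forall K : {set 'I_n}, #|K| = k ->
     exists dec : seq nat -> msg F B,
       forall m, dec [seq W a m | a <- enum K] = m) /\
  (forall (y : 'I_n) (D : {set 'I_n}), y \notin D -> #|D| = d ->
     exists S : 'I_n -> nat -> nat,
       (forall x, x \in D -> (entropy #|F| (fun m => S x (W x m)) <= beta)%R) /\
       exists rec : seq nat -> nat,
         forall m, rec [seq S x (W x m) | x <- enum D] = W y m).

Definition Bhat (k d : nat) (alpha beta : R) : R :=
  Rsum_seq (iota 1 k) (fun i => Rmin alpha ((INR d - INR i + 1) * beta)%R).

Definition eps0 (k d p : nat) (beta theta : R) : R :=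
  if (k - p + 1 < p)%N then
    (((INR d - INR k + 1) * (INR k - INR p) * (beta - theta) - theta) /
     ((INR d - INR k + 1) * (INR k - INR p + 1) + 1))%R
  else
    let q0 := ((k - p + 1) %/ p)%N in
    let c := (INR d - INR p * (INR q0 + 3) / 2 + 2)%R in
    ((c * INR q0 * (INR p - 1) * (beta - theta) - theta) /
     (c * INR q0 * INR p + 1))%R.

Definition eps1 (k d p : nat) (beta theta : R) : R :=
  if (k - p < p + 1)%N then
    ((INR d - INR k + 1) * ((INR k - INR p - 2) * beta + theta) /
     ((INR d - INR k + 1) * (INR k - INR p) + 1))%R
  else
    let q1 := ((k - p) %/ (p + 1))%N in
    let c := (INR d - (INR p + 1) * (INR q1 + 3) / 2 + 2)%R in
    (c * INR q1 * ((INR p - 1) * beta + theta) /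
     (c * INR q1 * (INR p + 1) + 1))%R.

Arguments is_ER_code : clear implicits.

(* Main.v *)
(* Let [gap] be the cut-set bound minus [B], and write [S_m^L] for the data sent
   by node [m] to repair the nodes of [L].  Along every ordering of the nodes the
   chain rule splits [B] into conditional entropies that are at most their
   cut-set terms, and the deficits add up to [gap].

   Take [m] outside a set [Q] of [s + 1] nodes containing [L], and bound
   [H(S_m^L)] by [sum_(l in L) H(S_m^l | W_Q) + I(W_m ; W_Q)].  Since [W_l] is
   recovered from the helper data it receives, [H(S_m^l | W_Q)] is what those
   data contain, given [Q :\ l], in excess of [W_l]; it and the mutual information
   are controlled by two deficits of one ordering.  For [s = p - 1] and [s = p]
   the resulting bound is well below [#|L| * beta]: what [m] sends to different
   nodes is strongly correlated.

   Now collect [s] nodes and then [q] consecutive blocks of [b] nodes, letting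
   each node [m] beyond a block [L] contribute [H(S_m^L)] instead of [b * beta].
   The saving bounds [B] away from the cut-set bound.  Here [s = p - 1] yields
   [eps0] and [s = p] yields [eps1]; in both, [b = k - s], [q = 1] gives the first
   case and [b = s + 1], [q = (k - s) %/ b] the second. *)

Require Import Defs.
From HB Require Import structures.
From mathcomp Require Import all_boot all_algebra.
From Stdlib Require Import Reals Lra.

Set Implicit Arguments.
Unset Strict Implicit.
Unset Printing Implicit Defensive.

(* Stdlib's [Reals] rebinds [%N] to its own [N_scope]. *)
Delimit Scope nat_scope with N.
Local Open Scope R_scope.

(** * Entropy of functions of a uniformly distributed message *)

Lemma RplusA : associative Rplus.
Proof. by move=> x y z; rewrite Rplus_assoc. Qed.

HB.instance Definition _ :=
  Monoid.isComLaw.Build R 0 Rplus RplusA Rplus_comm Rplus_0_l.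

Lemma Rsum_seqE (A : Type) (s : seq A) (g : A -> R) :
  Rsum_seq s g = \big[Rplus/0]_(a <- s) g a.
Proof. by elim: s => [|a s IH]; rewrite ?big_nil ?big_cons //= IH. Qed.

Lemma Rsum_le (I : Type) (r : seq I) (P : pred I) (F G : I -> R) :
  (forall i, P i -> F i <= G i) ->
  \big[Rplus/0]_(i <- r | P i) F i <= \big[Rplus/0]_(i <- r | P i) G i.
Proof. by move=> FG; elim/big_ind2: _ => //; [lra | move=> *; lra]. Qed.

Lemma Rsum_mull (I : Type) (r : seq I) (P : pred I) (c : R) (F : I -> R) :
  \big[Rplus/0]_(i <- r | P i) (c * F i) =
  c * \big[Rplus/0]_(i <- r | P i) F i.
Proof.
by apply/esym/big_morph => [x y|]; rewrite ?Rmult_plus_distr_l ?Rmult_0_r.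
Qed.

Lemma Rsum_const (T : finType) (P : pred T) (c : R) :
  \big[Rplus/0]_(i | P i) c = INR #|P| * c.
Proof.
rewrite big_const; elim: #|P| => [|n IH]; first by rewrite /=; ring.
by rewrite iterS IH S_INR; ring.
Qed.

Lemma Rsum_constT (T : finType) (c : R) :
  \big[Rplus/0]_(i : T) c = INR #|T| * c.
Proof. by rewrite Rsum_const; congr (INR _ * _); apply: eq_card. Qed.

Lemma ln_le_subr1 (x : R) : 0 < x -> ln x <= x - 1.
Proof.
move=> x0; case: (Req_dec x 1) => [->|x1]; first by rewrite ln_1; lra.
have ln0 : ln x <> 0.
  by move=> e; apply: x1; rewrite -(exp_ln x) // e exp_0.
by have := exp_ineq1 _ ln0; rewrite exp_ln //; lra.
Qed.

Lemma INR_gt0 (n : nat) : (0 < n)%N -> 0 < INR n.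
Proof. by move=> n0; apply: lt_0_INR; apply/ltP. Qed.

Lemma leq_INR (m n : nat) : (m <= n)%N -> INR m <= INR n.
Proof. by move=> mn; apply: le_INR; apply/leP. Qed.

Definition fiber (T : finType) (V : eqType) (f : T -> V) (m : T) : nat :=
  #|[pred m' | f m' == f m]|.

Lemma fiber_gt0 (T : finType) (V : eqType) (f : T -> V) (m : T) :
  0 < INR (fiber f m).
Proof. by apply: INR_gt0; apply/card_gt0P; exists m; rewrite inE. Qed.

Lemma eq_fiber (T : finType) (V : eqType) (f : T -> V) (m m' : T) :
  f m = f m' -> fiber f m = fiber f m'.
Proof. by move=> e; apply: eq_card => x; rewrite !inE e. Qed.

Lemma entropyE (q : nat) (T : finType) (V : eqType) (f : T -> V) :
  entropy q f =
  / (INR #|T| * ln (INR q)) *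
  \big[Rplus/0]_(m : T) (ln (INR #|T|) - ln (INR (fiber f m))).
Proof.
rewrite /entropy Rsum_seqE big_enum -Rsum_mull; apply: eq_bigr => m _.
have T0 : 0 < INR #|T| by apply: INR_gt0; apply/card_gt0P; exists m.
have f0 : 0 < INR (fiber f m) by apply: fiber_gt0.
rewrite /Rdiv ln_mult ?ln_Rinv //; last exact: Rinv_0_lt_compat.
by rewrite Rinv_mult; ring_simplify; rewrite /fiber; ring.
Qed.

Lemma ln_gt0 (q : nat) : (1 < q)%N -> 0 < ln (INR q).
Proof.
move=> q1; rewrite -ln_1; apply: ln_increasing; first lra.
by apply: (lt_INR 1); apply/ltP.
Qed.

Lemma entropy_scale_ge0 (q : nat) (T : finType) (m : T) :
  (1 < q)%N -> 0 <= / (INR #|T| * ln (INR q)).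
Proof.
move=> q1; apply/Rlt_le/Rinv_0_lt_compat/Rmult_lt_0_compat; last exact: ln_gt0.
by apply: INR_gt0; apply/card_gt0P; exists m.
Qed.

Lemma entropy_mono (q : nat) (T : finType) (U V : eqType)
    (f : T -> U) (g : T -> V) : (1 < q)%N ->
  (forall m m', f m = f m' -> g m = g m') -> entropy q g <= entropy q f.
Proof.
move=> q1 fg; rewrite !entropyE.
case: (pickP (fun _ : T => true)) => [m0 _|T0]; last first.
  by rewrite !big_pred0 //; lra.
apply: Rmult_le_compat_l; first exact: entropy_scale_ge0.
apply: Rsum_le => m _.
suff : ln (INR (fiber f m)) <= ln (INR (fiber g m)) by lra.
have le_fg : (fiber f m <= fiber g m)%N.
  by apply/subset_leq_card/subsetP=> x; rewrite !inE => /eqP/fg->.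
have f0 := fiber_gt0 f m; have := leq_INR le_fg.
by case/Rle_lt_or_eq_dec => [|->]; [move=> lt; apply/Rlt_le/ln_increasing | lra].
Qed.

Lemma entropy_const (q : nat) (T : finType) (V : eqType) (f : T -> V) :
  (forall m m', f m = f m') -> entropy q f = 0.
Proof.
move=> cf; rewrite entropyE big1 ?Rmult_0_r // => m _.
rewrite (_ : fiber f m = #|T|); first by ring.
by apply: eq_card => x; rewrite !inE (cf x m) eqxx.
Qed.

Lemma entropy_inj (q : nat) (T : finType) (V : eqType) (f : T -> V) (m0 : T) :
  injective f -> entropy q f = ln (INR #|T|) / ln (INR q).
Proof.
move=> inj; rewrite entropyE.
under eq_bigr => m _.
  rewrite (_ : fiber f m = 1%N) ?ln_1; last first.
    by rewrite -(card1 m); apply: eq_card => x; rewrite !inE (inj_eq inj).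
  over.
rewrite Rsum_constT Rinv_mult /Rdiv.
have : 0 < INR #|T| by apply: INR_gt0; apply/card_gt0P; exists m0.
by move: (/ ln (INR q)) => c N0; field; lra.
Qed.

(* For fixed x and y, the points m with [f m = f x] and [g m = g y] form a
   single fiber of (f, g), and they all lie in the z-fiber of x. *)
Lemma fiber_ratio_sum (T : finType) (U V Z : eqType)
    (f : T -> U) (g : T -> V) (z : T -> Z) (x y : T) :
  (forall m m', f m = f m' -> z m = z m') ->
  (forall m m', g m = g m' -> z m = z m') ->
  \big[Rplus/0]_(m : T | (f x == f m) && (g y == g m))
     / (INR (fiber (fun t => (f t, g t)) m) * INR (fiber z m)) <=
  (if z y == z x then / INR (fiber z x) else 0).
Proof.
move=> fz gz; set fg := fun t => (f t, g t).
have zx0 : 0 < / INR (fiber z x) by apply/Rinv_0_lt_compat/fiber_gt0.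
case: (pickP (fun m => (f x == f m) && (g y == g m))) => [m0 |none]; last first.
  by rewrite big_pred0 //; case: ifP => _; lra.
case/andP=> /eqP fx /eqP gy.
rewrite (fz _ _ fx) (gz _ _ gy) eqxx (eq_fiber (fz _ _ fx)).
rewrite (eq_bigl (fun m => fg m == fg m0)); last first.
  by move=> m; rewrite fx gy xpair_eqE eq_sym [g m == _]eq_sym.
rewrite (eq_bigr (fun _ => / (INR (fiber fg m0) * INR (fiber z m0)))); last first.
  move=> m /eqP e; rewrite (eq_fiber e) (@eq_fiber _ _ z m m0) //.
  by apply: fz; case: e.
rewrite Rsum_const -/(fiber fg m0).
have := fiber_gt0 fg m0; have := fiber_gt0 z m0 => *.
by apply: Req_le; field; lra.
Qed.

(** The product of the two fiber sizes counts pairs [(x, y)] with [f x = f m] and [g y = g m]. After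
    exchanging sums, only [y] in the [z]-fiber of [x] contribute, each at most the inverse of its
    size, so every [x] counts at most 1. *)
Lemma fiber_ratio_le (T : finType) (U V Z : eqType)
    (f : T -> U) (g : T -> V) (z : T -> Z) :
  (forall m m', f m = f m' -> z m = z m') ->
  (forall m m', g m = g m' -> z m = z m') ->
  \big[Rplus/0]_(m : T) (INR (fiber f m) * INR (fiber g m) /
     (INR (fiber (fun t => (f t, g t)) m) * INR (fiber z m))) <= INR #|T|.
Proof.
move=> fz gz; pose r m := / (INR (fiber (fun t => (f t, g t)) m) * INR (fiber z m)).
rewrite (eq_bigr (fun m => \big[Rplus/0]_(x | f x == f m)
                           \big[Rplus/0]_(y | g y == g m) r m)); last first.
  move=> m _; rewrite (eq_bigr (fun _ => INR (fiber g m) * r m)) => [|x _].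
    by rewrite Rsum_const /r /Rdiv -/(fiber f m); ring.
  by rewrite Rsum_const.
rewrite (exchange_big_dep xpredT) //=.
rewrite (eq_bigr (fun x => \big[Rplus/0]_y
    \big[Rplus/0]_(m | (f x == f m) && (g y == g m)) r m)); last first.
  by move=> x _; rewrite (exchange_big_dep xpredT).
apply: (Rle_trans _ (\big[Rplus/0]_(x : T) 1)); last first.
  by rewrite Rsum_constT Rmult_1_r; apply: Rle_refl.
apply: Rsum_le => x _.
apply: (Rle_trans _ (\big[Rplus/0]_y (if z y == z x then / INR (fiber z x) else 0))).
  by apply: Rsum_le => y _; apply: fiber_ratio_sum.
rewrite -big_mkcond Rsum_const -/(fiber z x) Rinv_r; first lra.
by have := fiber_gt0 z x; lra.
Qed.

(** This is nonnegativity of the mutual information of [f] and [g] given their common function [z]: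
    [ln t <= t - 1] is applied to the fiber ratio [t], whose mean is at most 1. *)
Lemma entropy_submod (q : nat) (T : finType) (U V Z : eqType)
    (f : T -> U) (g : T -> V) (z : T -> Z) : (1 < q)%N ->
  (forall m m', f m = f m' -> z m = z m') ->
  (forall m m', g m = g m' -> z m = z m') ->
  entropy q (fun m => (f m, g m)) + entropy q z <= entropy q f + entropy q g.
Proof.
move=> q1 fz gz; set fg := fun m => (f m, g m); rewrite !entropyE.
case: (pickP (fun _ : T => true)) => [m0 _|T0]; last first.
  by rewrite !big_pred0 //; lra.
rewrite -!Rmult_plus_distr_l -!big_split /=.
apply: Rmult_le_compat_l; first exact: entropy_scale_ge0.
set c := ln (INR #|T|).
have le : \big[Rplus/0]_m (c - ln (INR (fiber fg m)) + (c - ln (INR (fiber z m))))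
  <= \big[Rplus/0]_m ((c - ln (INR (fiber f m)) + (c - ln (INR (fiber g m)))) +
      (INR (fiber f m) * INR (fiber g m) /
       (INR (fiber fg m) * INR (fiber z m)) + -1)).
  apply: Rsum_le => m _.
  have f0 := fiber_gt0 f m; have g0 := fiber_gt0 g m.
  have fg0 := fiber_gt0 fg m; have z0 := fiber_gt0 z m.
  have fgz := Rmult_lt_0_compat _ _ fg0 z0.
  have fgi := Rinv_0_lt_compat _ fgz.
  have fg' := Rmult_lt_0_compat _ _ f0 g0.
  have := ln_le_subr1 (Rmult_lt_0_compat _ _ fg' fgi).
  by rewrite ln_mult // ln_Rinv // !ln_mult // /Rdiv; lra.
apply: (Rle_trans _ _ _ le); rewrite [X in X <= _]big_split.
rewrite [X in _ + X <= _]big_split /= Rsum_constT.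
rewrite -[X in _ <= X]Rplus_0_r; apply: Rplus_le_compat; first exact: Rle_refl.
apply: (Rle_trans _ (INR #|T| + INR #|T| * -1)); last by apply: Req_le; ring.
by apply: Rplus_le_compat_r; exact: fiber_ratio_le.
Qed.

(** * Joint entropies of node contents and helper data *)

Lemma card_interpolate (T : finType) (A B : {set T}) (k : nat) :
  A \subset B -> (#|A| <= k <= #|B|)%N ->
  exists K : {set T}, [/\ A \subset K, K \subset B & #|K| = k].
Proof.
move=> AB; elim: k => [|k IH] /andP[].
  by rewrite leqn0 => /eqP A0 _; exists A.
rewrite leq_eqVlt => /orP[/eqP Ak _ | Ak kB]; first by exists A.
have [|K [AK KB Kk]] := IH; first by rewrite -ltnS Ak ltnW.
have [x xB xK] : exists2 x, x \in B & x \notin K.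
  by apply/subsetPn; apply: contraL kB => /subset_leq_card; rewrite Kk -leqNgt.
exists (x |: K); split; last by rewrite cardsU1 xK Kk.
- exact: subset_trans AK (subsetUr _ _).
- by apply/subsetP=> z; rewrite !inE => /orP[/eqP->//|/(subsetP KB)].
Qed.

(* [h A X] stands for the joint entropy of the contents of the nodes in [A] and
   of the helper data in [X], where [(x, y)] is sent by [x] to repair [y]. *)
Record repair_entropy (N : finType) (d k : nat) (alpha beta B : R)
    (h : {set N} -> {set N * N} -> R) : Prop := {
  rh_card : #|N| = d.+1;
  rh0 : h set0 set0 = 0;
  rh_mono : forall (A A' : {set N}) (X X' : {set N * N}),
    A \subset A' -> X \subset X' -> h A X <= h A' X';
  rh_submod : forall (A A' : {set N}) (X X' : {set N * N}),
    h (A :|: A') (X :|: X') + h (A :&: A') (X :&: X') <= h A X + h A' X';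
  rh_stored : forall x, h [set x] set0 <= alpha;
  rh_helper : forall e, h set0 [set e] <= beta;
  rh_sent : forall (A : {set N}) (X Y : {set N * N}),
    (forall e, e \in X -> e.1 \in A) ->
    h A (X :|: Y) <= h A Y;
  rh_repair : forall (A : {set N}) (X : {set N * N}) y,
    (forall x, x != y -> (x, y) \in X) ->
    h (y |: A) X <= h A X;
  rh_collect : forall K : {set N}, #|K| = k -> h K set0 = B
}.

(** Indexed from 0: [i] is the number of nodes already collected when the next one arrives. *)
Definition cut_term (d : nat) (alpha beta : R) (i : nat) : R :=
  Rmin alpha ((INR d - INR i) * beta).

(* [{set N * N}] elaborates with or without an identity [reverse_coercion],
   which [lra] would take for different atoms. *)
Local Ltac set_lra := unfold reverse_coercion in *; lra.

(** * Repair costs and the chain rule *)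

Section RepairEntropy.
Context (N : finType) (d k : nat) (alpha beta B : R).
Context (h : {set N} -> {set N * N} -> R).
Hypothesis hP : repair_entropy d k alpha beta B h.

Notation cut := (cut_term d alpha beta).
Notation gap := (\big[Rplus/0]_(0 <= i < k) cut i - B).
Implicit Types (A C L P Q Z : {set N}) (X Y : {set N * N}).

Lemma rh_subadd A A' X X' :
  h (A :|: A') (X :|: X') <= h A X + h A' X'.
Proof.
have := rh_submod hP A A' X X'.
have := rh_mono hP (sub0set (A :&: A')) (sub0set (X :&: X')).
by rewrite (rh0 hP); set_lra.
Qed.

(** Helper data are added one at a time; by submodularity, what a datum adds given [A] and [Y] can
    only shrink once further data are known. *)
Lemma rh_helpers A X Y t :
  (forall e, e \in X -> h A (e |: Y) <= h A Y + t) ->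
  h A (X :|: Y) <= h A Y + INR #|X| * t.
Proof.
move En: #|X| => n; elim: n X En => [|n IH] X En Xt.
  by move/eqP: En; rewrite cards_eq0 => /eqP->; rewrite set0U /=; set_lra.
have [e eX] : exists e, e \in X by apply/card_gt0P; rewrite En.
have cX : #|X :\ e| = n.
  by apply/eqP; rewrite -eqSS -En [in X in _ == X](cardsD1 e) eX.
have {}IH : h A (X :\ e :|: Y) <= h A Y + INR n * t.
  by apply: IH => // x; rewrite inE => /andP[_ /Xt].
have := Xt _ eX; have := rh_submod hP A A (X :\ e :|: Y) (e |: Y).
have -> : X :\ e :|: Y :|: (e |: Y) = X :|: Y.
  apply/setP=> z; rewrite !inE; case: eqP => [->|_] /=; first by rewrite eX orbT.
  by case: (z \in X); case: (z \in Y).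
rewrite !setUid setIid S_INR.
have : h A Y <= h A ((X :\ e :|: Y) :&: (e |: Y)).
  by apply: (rh_mono hP) => //; rewrite subsetI !subsetUr.
set_lra.
Qed.

Lemma rh_helpers_beta A X Y :
  h A (X :|: Y) <= h A Y + INR #|X| * beta.
Proof.
apply: rh_helpers => e _; have := rh_subadd A set0 Y [set e].
by rewrite setU0 setUC; have := rh_helper hP e; set_lra.
Qed.

(** Help from [A] is determined by stored contents and help in [X] is present, so only [Z] is paid
    for. The help from [Z] is kept on the left, so that its excess over the content of [y] can be
    bounded. *)
Lemma rh_repair_le A Z X y :
  (forall x, x != y -> [|| x \in A, x \in Z | (x, y) \in X]) ->
  h (y |: A) (setX Z [set y] :|: X) <= h A X + INR #|Z| * beta.
Proof.
move=> AZX; pose S := setX A [set y].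
have cZ : #|setX Z [set y]| = #|Z| by rewrite cardsX cards1 muln1.
rewrite -cZ; apply: Rle_trans _ _ _ _ (rh_helpers_beta A _ X).
apply: (Rle_trans _ (h (y |: A) (S :|: (setX Z [set y] :|: X)))).
  by apply: (rh_mono hP); rewrite ?subxx ?subsetUr.
apply: (Rle_trans _ (h A (S :|: (setX Z [set y] :|: X)))).
  apply: (rh_repair hP) => x /AZX; rewrite !inE /= eqxx !andbT.
  by case/or3P=> ->; rewrite ?orbT.
by apply: (rh_sent hP) => -[x z]; rewrite inE => /andP[].
Qed.

Lemma rh_node_incr A y :
  y \notin A -> h (y |: A) set0 <= h A set0 + cut #|A|.
Proof.
move=> yA; pose Z := ~: (y |: A).
have Ad : (#|A| <= d)%N.
  by have := max_card (mem (y |: A)); rewrite (rh_card hP) cardsU1 yA.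
have cZ : #|Z| = (d - #|A|)%N by rewrite cardsCs setCK (rh_card hP) cardsU1 yA.
have : h (y |: A) set0 <= h A set0 + INR #|Z| * beta.
  apply: (Rle_trans _ (h (y |: A) (setX Z [set y] :|: set0))).
    by apply: (rh_mono hP); rewrite ?subxx ?sub0set.
  apply: rh_repair_le => x; rewrite /Z !inE => /negPf->.
  by case: (x \in A).
have := rh_subadd [set y] A set0 set0; rewrite setU0.
have := rh_stored hP y.
rewrite cZ minus_INR; last exact/leP.
by rewrite /cut_term /Rmin; case: Rle_dec; set_lra.
Qed.

Lemma rh_nodes_incr A C :
  A \subset C ->
  h C set0 <= h A set0 + \big[Rplus/0]_(#|A| <= i < #|C|) cut i.
Proof.
move En: #|C| => n; elim: n C En => [|n IH] C En AC.
  have C0 : C = set0 by apply/eqP; rewrite -cards_eq0 En.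
  move: AC; rewrite C0 subset0 => /eqP->.
  by rewrite big_geq //; set_lra.
have [CA|] := boolP (C \subset A).
  have -> : A = C by apply/eqP; rewrite eqEsubset AC.
  by rewrite En big_geq //; set_lra.
case/subsetPn=> x xC xA.
have cD : #|C :\ x| = n.
  by apply/eqP; rewrite -eqSS -En [in X in _ == X](cardsD1 x) xC.
have AD : A \subset C :\ x by rewrite subsetD1 AC.
have An : (#|A| <= n)%N by rewrite -cD subset_leq_card.
have := IH _ cD AD; rewrite big_nat_recr //=.
have : x \notin C :\ x by rewrite !inE eqxx.
by move/rh_node_incr; rewrite setD1K // cD; set_lra.
Qed.

(* Both conditional entropies in [h (m |: Q) - h (Q :\ l)] fall short of their
   cut terms by a nonnegative amount, and in the chain-rule expansion of [B]
   along an order starting with [Q :\ l], [l], [m] all such amounts add up to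
   the gap. *)
Lemma rh_two_deficits Q l m s :
  (k <= d.+1)%N -> (s.+2 <= k)%N -> #|Q| = s.+1 -> l \in Q -> m \notin Q ->
  h (Q :\ l) set0 + cut s + cut s.+1 <= h (m |: Q) set0 + gap.
Proof.
move=> kd sk cQ lQ mQ.
have cmQ : #|m |: Q| = s.+2 by rewrite cardsU1 mQ cQ.
have cQl : #|Q :\ l| = s.
  by apply/eqP; rewrite -eqSS -cQ [in X in _ == X](cardsD1 l) lQ.
have [|K [QK _ cK]] := @card_interpolate _ (m |: Q) setT k (subsetT _).
  by rewrite cmQ sk cardsT (rh_card hP).
have := rh_nodes_incr QK; rewrite cmQ cK (rh_collect hP cK).
have := rh_nodes_incr (sub0set (Q :\ l)); rewrite cards0 cQl (rh0 hP).
rewrite (@big_cat_nat _ _ _ s.+2 0 k) //= 2?big_nat_recr //=; set_lra.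
Qed.

(** * Joint entropy of the helper data sent by one node *)

Definition helpers_bound (s b : nat) : R :=
  alpha - cut s.+1 + INR b * ((INR d - INR s) * beta - cut s + gap).

Lemma rh_helpers_bound L m s :
  (k <= d)%N -> (s.+2 <= k)%N -> m \notin L -> (0 < #|L| <= s.+1)%N ->
  h set0 (setX [set m] L) <= helpers_bound s #|L|.
Proof.
move=> kd sk mL /andP[L0 Ls]; set S := setX _ _.
have sd : (s < d)%N by apply: leq_trans kd; apply: ltnW.
have [||Q [LQ Qm cQ]] := @card_interpolate _ L (~: [set m]) s.+1.
- by apply/subsetP=> x xL; rewrite !inE; apply: contra mL => /eqP<-.
- by rewrite Ls cardsC1 (rh_card hP).
have mQ : m \notin Q by apply/negP=> /(subsetP Qm); rewrite !inE eqxx.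
(* Since [m] determines [S], submodularity gives H(S) <= H(S | W_Q) + I(W_m ; W_Q), here with
   [alpha] in place of H(W_m). *)
have mutual : h (m |: Q) set0 + h set0 S <= h Q S + alpha.
  have := rh_submod hP [set m] Q S S; rewrite !setUid !setIid.
  have -> : [set m] :&: Q = set0.
    by apply/setP=> x; rewrite !inE; case: eqP => // ->; apply/negbTE.
  have : h [set m] (S :|: set0) <= h [set m] set0.
    by apply: (rh_sent hP) => -[x z]; rewrite in_setX => /andP[].
  have : h (m |: Q) set0 <= h (m |: Q) S by apply: (rh_mono hP); rewrite ?sub0set.
  by rewrite setU0; have := rh_stored hP m; set_lra.
set w := cut s.+1 + h Q set0 - h (m |: Q) set0.
have w0 : 0 <= w by have := rh_node_incr mQ; rewrite cQ /w; set_lra.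
pose t := (INR d - INR s) * beta - cut s + gap - w.
have cS : #|S| = #|L| by rewrite cardsX cards1 mul1n.
have : h Q (S :|: set0) <= h Q set0 + INR #|S| * t.
  apply: rh_helpers => -[m' l]; rewrite !inE /= => /andP[/eqP-> lL].
  have lQ := subsetP LQ _ lL.
  have := @rh_repair_le (Q :\ l) (~: Q) set0 l; rewrite setD1K // !setU0.
  have -> : INR #|~: Q| = INR d - INR s.
    by rewrite cardsCs setCK (rh_card hP) cQ subSS minus_INR //; apply/leP/ltnW.
  have : h Q [set (m, l)] <= h Q (setX (~: Q) [set l]).
    by apply: (rh_mono hP); rewrite ?subxx // sub1set !inE eqxx andbT.
  have := rh_two_deficits (leqW kd) sk cQ lQ mQ => a1 a2 a3.
  suff : h Q (setX (~: Q) [set l]) <= h (Q :\ l) set0 + (INR d - INR s) * beta.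
    by rewrite /t /w; set_lra.
  by apply: a3 => x xl; rewrite !inE xl /=; case: (x \in Q).
rewrite setU0 cS /helpers_bound /t; have b1 : INR 1 <= INR #|L| := leq_INR L0.
have : w * INR 1 <= w * INR #|L| by apply: Rmult_le_compat_l.
have wE : w = cut s.+1 + h Q set0 - h (m |: Q) set0 by [].
move: (w) wE => w' wE /= wb hS; set_lra.
Qed.

(** * Collecting the nodes in blocks *)

Lemma rh_block P L U :
  [disjoint P & L] -> (forall m, m \notin L -> h set0 (setX [set m] L) <= U) ->
  h (P :|: L) set0 <= h P set0 +
    \big[Rplus/0]_(#|P| <= i < #|P| + #|L|) ((INR d - INR i) * beta) -
    (INR d + 1 - INR #|P| - INR #|L|) * (INR #|L| * beta - U).
Proof.
(* Everything that the nodes [M] beyond the block send to [L] is revealed first, at cost [U] per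
   node of [M]; then the nodes of [L] are repaired in turn. *)
move=> dPL LU; pose M := ~: (P :|: L); pose X := setX M L.
have cPL : #|P :|: L| = (#|P| + #|L|)%N.
  by rewrite cardsU disjoint_setI0 // cards0 subn0.
have PLd : (#|P| + #|L| <= d.+1)%N.
  by rewrite -cPL -(rh_card hP) max_card.
have cM : INR #|M| = INR d + 1 - INR #|P| - INR #|L|.
  rewrite /M cardsCs setCK (rh_card hP) cPL minus_INR; last exact/leP.
  by rewrite plus_INR S_INR; ring.
have hX : h P X <= h P set0 + INR #|M| * U.
  rewrite (_ : X = \bigcup_(m in M) setX [set m] L); last first.
    apply/setP=> -[m l]; rewrite in_setX /=; apply/andP/bigcupP => [[mM lL]|[m' m'M]].
      by exists m; rewrite ?in_setX ?set11.
    by rewrite in_setX /= => /andP[/set1P-> ->]; rewrite m'M.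
  have : {subset M <= M} by [].
  move: {1 3 4}M => V; move En: #|V| => n; elim: n V En => [|n IH] V En NM.
    by move/eqP: En; rewrite cards_eq0 => /eqP->; rewrite big_set0 /=; set_lra.
  have [e eN] : exists e, e \in V by apply/card_gt0P; rewrite En.
  have cV : #|V :\ e| = n.
    by apply/eqP; rewrite -eqSS -En [in X in _ == X](cardsD1 e) eN.
  rewrite S_INR (bigD1 e) //=.
  rewrite (eq_bigl (fun i => i \in V :\ e)); last by move=> i; rewrite !inE andbC.
  set Y := \bigcup_(i in _) _; have := IH _ cV.
  have := rh_subadd set0 P (setX [set e] L) Y; rewrite set0U.
  have : h set0 (setX [set e] L) <= U.
    by apply: LU; have := NM _ eN; rewrite !inE negb_or => /andP[].
  move=> a1 a2 a3; have : {subset V :\ e <= M} by move=> x; rewrite inE => /andP[_ /NM].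
  by move/a3; rewrite -/Y; set_lra.
have hL : forall V : {set N}, V \subset L -> h (P :|: V) X <= h P X +
    \big[Rplus/0]_(#|P| <= i < #|P| + #|V|)
      ((INR d - INR i) * beta - INR #|M| * beta).
  move=> V; move En: #|V| => n; elim: n V En => [|n IH] V En NL.
    move/eqP: En; rewrite cards_eq0 => /eqP->; rewrite setU0 big_geq ?addn0 //.
    set_lra.
  have [y yN] : exists e, e \in V by apply/card_gt0P; rewrite En.
  have cV : #|V :\ y| = n.
    by apply/eqP; rewrite -eqSS -En [in X in _ == X](cardsD1 y) yN.
  have := IH _ cV (subset_trans (subsetDl _ _) NL).
  rewrite addnS big_nat_recr ?leq_addr //=.
  (* The help from [M] is already in [X], so repairing [y] costs [beta] only for each node of [L]
     not yet recovered. *)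
  pose Z := L :\: V.
  have := @rh_repair_le (P :|: V :\ y) Z X y.
  rewrite setUCA setD1K // => rep.
  have {}rep : h (P :|: V) X <= h (P :|: V :\ y) X + INR #|Z| * beta.
    apply: Rle_trans (rep _).
      by apply: (rh_mono hP); rewrite ?subxx ?subsetUr.
    move=> x xy; rewrite !inE xy (subsetP NL _ yN) /= andbT.
    by case: (x \in P); case: (x \in V); case: (x \in L).
  have cZ : INR #|Z| = INR d - INR (#|P| + n) - INR #|M|.
    rewrite cM plus_INR /Z cardsD (setIidPr NL) En minus_INR; last first.
      by apply/leP; rewrite -En subset_leq_card.
    by rewrite !S_INR; ring.
  by rewrite cZ in rep; set_lra.
have := hL _ (subxx L).
have : h (P :|: L) set0 <= h (P :|: L) X by apply: (rh_mono hP); rewrite ?sub0set.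
have -> : \big[Rplus/0]_(#|P| <= i < #|P| + #|L|)
              ((INR d - INR i) * beta - INR #|M| * beta) =
          \big[Rplus/0]_(#|P| <= i < #|P| + #|L|) ((INR d - INR i) * beta) -
          INR #|M| * (INR #|L| * beta).
  move: (#|L|) => n; elim: n => [|n IH].
    by rewrite addn0 !big_geq //=; ring.
  by rewrite S_INR addnS !big_nat_recr ?leq_addr //= IH; ring.
by rewrite -cM; set_lra.
Qed.

(* Number of pairs (block, node beyond it) when [q] consecutive blocks of [b]
   nodes follow the first [s] of the [d + 1] nodes. *)
Definition blocks_weight (s b q : nat) : R :=
  INR q * (INR d + 1 - INR s) - INR b * INR q * (INR q + 1) / 2.

Lemma blocks_weightS s b q :
  blocks_weight s b q.+1 =
  blocks_weight s b q + (INR d + 1 - INR (s + q * b) - INR b).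
Proof. by rewrite /blocks_weight plus_INR mult_INR !S_INR; field. Qed.

Lemma blocks_weight_ge0 s b q :
  (s + q * b <= d.+1)%N -> 0 <= blocks_weight s b q.
Proof.
elim: q => [|q IH] sq; first by rewrite /blocks_weight /=; lra.
rewrite blocks_weightS; have := leq_INR sq; rewrite S_INR.
have : (s + q * b <= d.+1)%N by apply: leq_trans sq; rewrite leq_add2l leq_mul.
by move/IH; rewrite mulSn !plus_INR; lra.
Qed.

Lemma rh_blocks s b q :
  (k <= d)%N -> (s.+2 <= k)%N -> (0 < b <= s.+1)%N -> (s + q * b <= k)%N ->
  exists2 P : {set N}, #|P| = (s + q * b)%N & h P set0 <=
    \big[Rplus/0]_(0 <= i < s) cut i +
    \big[Rplus/0]_(s <= i < s + q * b) ((INR d - INR i) * beta) -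
    blocks_weight s b q * (INR b * beta - helpers_bound s b).
Proof.
move=> kd sk bs; elim: q => [|q IH] qk.
  have [|P [_ _ cP]] := @card_interpolate N set0 setT s (subsetT _).
    rewrite cards0 cardsT (rh_card hP) /=; apply: leq_trans (leqW kd).
    by apply: leq_trans sk; rewrite leqW.
  exists P; first by rewrite cP mul0n addn0.
  have := rh_nodes_incr (sub0set P); rewrite cards0 cP (rh0 hP).
  by rewrite mul0n addn0 [\big[_/_]_(s <= i < s) _]big_geq // /blocks_weight /=; set_lra.
have q1k : (s + q * b <= k)%N.
  by apply: leq_trans qk; rewrite leq_add2l leq_mul.
have [P cP hPb] := IH q1k.
(* Any [b] nodes outside [P] can form the next block, as the bounds depend on cardinalities only. *)
have [|L [_ LP cL]] := @card_interpolate N set0 (~: P) b (sub0set _).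
  rewrite cards0 cardsCs setCK (rh_card hP) cP /= leq_subRL; last first.
    by apply: leq_trans (leqW kd).
  by apply: leq_trans (leqW kd); rewrite -addnA -[(_ + b)%N]addnC -mulSn.
have dPL : [disjoint P & L] by rewrite disjoint_sym disjoints_subset.
exists (P :|: L).
  by rewrite cardsU disjoint_setI0 // cards0 subn0 cP cL mulSn [(b + _)%N]addnC addnA.
have := @rh_block P L (helpers_bound s b) dPL.
rewrite cP cL => blk; rewrite blocks_weightS.
rewrite (@big_cat_nat _ _ _ (s + q * b) s (s + q.+1 * b)) ?leq_addr //=; last first.
  by rewrite leq_add2l leq_mul.
have -> : (s + q.+1 * b = s + q * b + b)%N by rewrite mulSn [(b + _)%N]addnC addnA.
have {}blk := blk _; apply: Rle_trans (blk _) _ => [m mL|]; last by set_lra.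
by rewrite -cL; apply: rh_helpers_bound => //; rewrite cL.
Qed.

(** The blocks are completed to [k] nodes, which determine the file. The sum on the right is the
    loss from charging [(d - i) * beta] rather than the cut term from index [s] on. The gap also
    occurs inside [helpers_bound], so the inequality remains to be solved for it. *)
Lemma rh_gap s b q :
  (k <= d)%N -> (s.+2 <= k)%N -> (0 < b <= s.+1)%N -> (s + q * b <= k)%N ->
  blocks_weight s b q * (INR b * beta - helpers_bound s b) <=
  gap + \big[Rplus/0]_(s <= i < k) ((INR d - INR i) * beta - cut i).
Proof.
move=> kd sk bs qk; have [P cP hPb] := rh_blocks kd sk bs qk.
have [|K [PK _ cK]] := @card_interpolate _ P setT k (subsetT _).
  by rewrite cP qk cardsT (rh_card hP) leqW.
have := rh_nodes_incr PK; rewrite cP cK (rh_collect hP cK).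
have sk' : (s <= k)%N by apply: leq_trans sk; rewrite leqW.
set w := blocks_weight _ _ _ * _ in hPb *.
have : \big[Rplus/0]_(s + q * b <= i < k) cut i <=
       \big[Rplus/0]_(s + q * b <= i < k) ((INR d - INR i) * beta).
  by apply: Rsum_le => i _; apply: Rmin_r.
have E : \big[Rplus/0]_(s <= i < k) ((INR d - INR i) * beta - cut i) +
         \big[Rplus/0]_(s <= i < k) cut i =
         \big[Rplus/0]_(s <= i < k) ((INR d - INR i) * beta).
  by rewrite -big_split /=; apply: eq_bigr => i _; ring.
rewrite [\big[_/_]_(0 <= i < k) _](@big_cat_nat _ _ _ s) //=.
rewrite [in RHS](@big_cat_nat _ _ _ (s + q * b)) ?leq_addr //= in E.
set_lra.
Qed.

End RepairEntropy.

(** * The entropy function of a code *)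

Definition joint (T N E : finType) (w : N -> T -> nat) (u : E -> T -> nat)
    (A : {set N}) (X : {set E}) (m : T) :=
  ([ffun x => if x \in A then w x m else 0%N],
   [ffun e => if e \in X then u e m else 0%N]).

(** The default 0 outside [A] and [X] gives all joint variables one type and never distinguishes two
    messages. *)
Lemma jointP (T N E : finType) (w : N -> T -> nat) (u : E -> T -> nat)
    (A : {set N}) (X : {set E}) (m m' : T) :
  joint w u A X m = joint w u A X m' <->
  {in A, forall x, w x m = w x m'} /\ {in X, forall e, u e m = u e m'}.
Proof.
split=> [[/ffunP eA /ffunP eX]|[eA eX]].
  split=> [x xA|e eX'].
    by have := eA x; rewrite !ffunE xA.
  by have := eX e; rewrite !ffunE eX'.
congr pair; apply/ffunP=> z; rewrite !ffunE; case: ifP => //.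
- exact: eA.
- exact: eX.
Qed.

(** Only the first [d + 1] nodes are kept: each is then repaired by all the others, so helper data
    are indexed by pairs of nodes. *)
Lemma ER_code_repair_entropy (F : finFieldType) (n k d B : nat)
    (alpha beta : R) (W : 'I_n -> msg F B -> nat) :
  (d < n)%N -> 0 < beta -> is_ER_code F n k d B alpha beta W ->
  exists h : {set 'I_d.+1} -> {set 'I_d.+1 * 'I_d.+1} -> R,
    repair_entropy d k alpha beta (INR B) h.
Proof.
move=> dn beta0 [Walpha [dc rep]].
have q1 : (1 < #|F|)%N := card_finNzRing_gt1 F.
have emb_inj : injective (widen_ord dn) by move=> x y /(congr1 val) /= /val_inj.
set emb := widen_ord dn in emb_inj *.
have /fin_all_exists[S SP] (y : 'I_d.+1) : exists S : 'I_n -> nat -> nat,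
    (forall x, x != y -> entropy #|F| (fun m => S (emb x) (W (emb x) m)) <= beta) /\
    (forall m m', (forall x, x != y ->
        S (emb x) (W (emb x) m) = S (emb x) (W (emb x) m')) ->
      W (emb y) m = W (emb y) m').
  pose D := emb @: [set~ y].
  have yD : emb y \notin D.
    by apply/imsetP=> -[x + /emb_inj xy]; rewrite !inE xy eqxx.
  have cD : #|D| = d by rewrite card_imset // cardsC1 card_ord.
  have [S [Sb [rec recP]]] := rep _ _ yD cD.
  exists S; split=> [x xy|m m' e].
    by apply: Sb; apply: imset_f; rewrite !inE.
  rewrite -!recP; congr rec; apply/eq_in_map => z; rewrite mem_enum.
  by case/imsetP=> x; rewrite !inE => xy ->; apply: e.
pose w x m := W (emb x) m.
(* No node helps itself; a diagonal pair carries a constant, of entropy 0, so that the bound [beta]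
   holds for every pair. *)
pose u (e : 'I_d.+1 * 'I_d.+1) m :=
  if e.1 == e.2 then 0%N else S e.2 (emb e.1) (w e.1 m).
have detE (A A' : {set 'I_d.+1}) (X X' : {set 'I_d.+1 * 'I_d.+1}) :
    (forall m m', {in A, forall x, w x m = w x m'} ->
       {in X, forall e, u e m = u e m'} ->
     {in A', forall x, w x m = w x m'} /\ {in X', forall e, u e m = u e m'}) ->
    entropy #|F| (joint w u A' X') <= entropy #|F| (joint w u A X).
  move=> det; apply: entropy_mono => // m m' /jointP[eA eX]; apply/jointP.
  exact: det.
exists (fun A X => entropy #|F| (joint w u A X)); split.
- exact: card_ord.
- by apply: entropy_const => m m'; apply/jointP; split=> x; rewrite inE.
- move=> A A' X X' AA' XX'; apply: detE => m m' eA eX.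
  by split=> z => [/(subsetP AA')/eA | /(subsetP XX')/eX].
- move=> A A' X X'.
  have := @entropy_submod _ _ _ _ _ (joint w u A X) (joint w u A' X')
            (joint w u (A :&: A') (X :&: X')) q1.
  have sub : entropy #|F| (joint w u (A :|: A') (X :|: X')) <=
             entropy #|F| (fun m => (joint w u A X m, joint w u A' X' m)).
    apply: entropy_mono => // m m' e.
    have /jointP[eA eX] := congr1 fst e; have /jointP[eA' eX'] := congr1 snd e.
    apply/jointP; split=> z; rewrite inE => /orP[].
    + exact: eA.
    + exact: eA'.
    + exact: eX.
    + exact: eX'.
  move=> sm; apply: Rle_trans (sm _ _); first exact: Rplus_le_compat_r.
    move=> m m' /jointP[eA eX]; apply/jointP.
    by split=> z; rewrite inE => /andP[zl _]; [apply: eA | apply: eX].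
  move=> m m' /jointP[eA eX]; apply/jointP.
  by split=> z; rewrite inE => /andP[_ zr]; [apply: eA | apply: eX].
- move=> x; apply: Rle_trans (Walpha (emb x)); apply: entropy_mono => // m m' e.
  by apply/jointP; split=> z; rewrite inE // => /eqP->.
- move=> [x y]; case: (eqVneq x y) => [xy|xy].
    rewrite entropy_const; first lra.
    move=> m m'; apply/jointP; split=> z; rewrite inE // => /eqP->.
    by rewrite /u /= xy eqxx.
  apply: Rle_trans ((SP y).1 x xy); apply: entropy_mono => // m m' e.
  apply/jointP; split=> z; rewrite inE // => /eqP->.
  by rewrite /u /= (negPf xy).
- move=> A X Y XA; apply: detE => m m' eA eY; split=> // e.
  rewrite inE => /orP[/XA eA'|/eY//].
  by rewrite /u (eA _ eA').
- move=> A X y Xy; apply: detE => m m' eA eX; split=> // x.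
  rewrite !inE => /orP[/eqP->|/eA//].
  apply: (SP y).2 => x' x'y; have := eX _ (Xy _ x'y).
  by rewrite /u /= (negPf x'y).
- move=> K cK.
  have cE : #|emb @: K| = k by rewrite card_imset.
  have [dec decP] := dc _ cE.
  have inj : injective (joint w u K set0).
    move=> m m' /jointP[eK _]; rewrite -(decP m) -(decP m'); congr dec.
    apply/eq_in_map => z; rewrite mem_enum => /imsetP[x xK ->].
    exact: eK.
  (* [dec [::]] serves only as some message, witnessing that the message type is inhabited. *)
  rewrite (entropy_inj _ (dec [::]) inj).
  have q0 : 0 < INR #|F| by apply: INR_gt0; apply: ltnW.
  have l0 := ln_gt0 q1.
  rewrite card_tuple; have -> : INR (expn #|F| B) = (INR #|F|) ^ B.
    elim: B {W Walpha dc rep S SP w u detE K cK cE dec decP inj} => //= b IH.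
    by rewrite expnS mult_INR IH.
  by rewrite ln_pow //; field; lra.
Qed.

(** * The gap to the cut-set bound *)

Lemma BhatE (k d : nat) (alpha beta : R) :
  Bhat k d alpha beta = \big[Rplus/0]_(0 <= i < k) cut_term d alpha beta i.
Proof.
rewrite /Bhat Rsum_seqE; have -> : iota 1 k = index_iota 1 k.+1.
  by rewrite /index_iota subSS subn0.
rewrite big_add1 /=; apply: eq_bigr => i _.
by rewrite /cut_term -/(INR i.+1) S_INR; congr (Rmin _ (_ * _)); ring.
Qed.

Section CutTerms.
Context (d p : nat) (alpha beta theta : R).
Hypothesis (beta0 : 0 < beta) (theta_ge0 : 0 <= theta) (theta_lt : theta < beta).
Hypothesis alphaE : alpha = (INR d - INR p + 1) * beta - theta.

(** The range of [theta] places [alpha] above [(d - p) * beta] and at most at [(d - p + 1) * beta],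
    so the minimum switches at index [p]. *)
Lemma cut_term_lt i : (i < p)%N -> cut_term d alpha beta i = alpha.
Proof.
move=> ip; have := leq_INR ip; rewrite S_INR => le.
apply: Rmin_left; rewrite alphaE.
have : 0 <= (INR p - 1 - INR i) * beta by apply: Rmult_le_pos; lra.
lra.
Qed.

Lemma cut_term_ge i : (p <= i)%N -> cut_term d alpha beta i = (INR d - INR i) * beta.
Proof.
move=> pi; have le := leq_INR pi.
apply: Rmin_right; rewrite alphaE.
have : 0 <= (INR i - INR p) * beta by apply: Rmult_le_pos; lra.
lra.
Qed.

Lemma cut_term_slack_ge s k : (p <= s)%N ->
  \big[Rplus/0]_(s <= i < k) ((INR d - INR i) * beta - cut_term d alpha beta i) = 0.
Proof.
move=> ps; rewrite big_nat; apply: big1 => i /andP[si _].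
by rewrite cut_term_ge ?(leq_trans ps) //; ring.
Qed.

End CutTerms.

Lemma ler_div_addr1 (x c e : R) : 0 <= c -> x <= e * (c + 1) -> x / (c + 1) <= e.
Proof.
move=> c0 xe; apply: (Rmult_le_reg_r (c + 1)); first lra.
by rewrite /Rdiv Rmult_assoc Rinv_l; lra.
Qed.

Section Gap.
Context (N : finType) (d k p : nat) (alpha beta theta B : R).
Context (h : {set N} -> {set N * N} -> R).
Hypothesis hP : repair_entropy d k alpha beta B h.
Hypothesis (kd : (k <= d)%N) (p0 : (0 < p)%N).
Hypothesis (beta0 : 0 < beta) (theta_ge0 : 0 <= theta) (theta_lt : theta < beta).
Hypothesis alphaE : alpha = (INR d - INR p + 1) * beta - theta.

Local Notation gap := (Bhat k d alpha beta - B).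

(** With [s = p - 1] the saving per pair is [(b - 1) * (beta - theta) - b * gap], and the only loss
    is [theta], at index [p - 1]. Collecting the gap on one side gives the denominator
    [w * b + 1]. *)
Lemma gap_ge_blocks0 b q :
  (p.+1 <= k)%N -> (0 < b <= p)%N -> (p.-1 + q * b <= k)%N ->
  let w := blocks_weight d p.-1 b q in
  (w * (INR b - 1) * (beta - theta) - theta) / (w * INR b + 1) <= gap.
Proof.
move=> pk bp qk w.
have w0 : 0 <= w by apply: blocks_weight_ge0; apply: leq_trans (leqW kd).
have := @rh_gap _ _ _ _ _ _ _ hP p.-1 b q; rewrite -BhatE !prednK // -/w.
move=> /(_ kd pk bp qk); rewrite /helpers_bound -BhatE prednK //.
have p1p : (p.-1 < p)%N by rewrite prednK.
rewrite big_ltn ?prednK //; last exact: ltnW pk.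
rewrite (cut_term_slack_ge beta0 theta_lt alphaE) //.
rewrite !(cut_term_lt beta0 theta_ge0 alphaE p1p).
rewrite (cut_term_ge beta0 theta_lt alphaE (leqnn p)).
have -> : INR p.-1 = INR p - 1 by rewrite -{2}(prednK p0) S_INR; ring.
rewrite alphaE => le; apply: ler_div_addr1; last by lra.
by apply: Rmult_le_pos => //; apply: pos_INR.
Qed.

(** With [s = p] nothing is lost, as all cut terms from [p] on equal [(d - i) * beta]; the saving
    per pair is [(b - 2) * beta + theta - b * gap]. *)
Lemma gap_ge_blocks1 b q :
  (p.+2 <= k)%N -> (0 < b <= p.+1)%N -> (p + q * b <= k)%N ->
  let w := blocks_weight d p b q in
  w * ((INR b - 2) * beta + theta) / (w * INR b + 1) <= gap.
Proof.
move=> pk bp qk w.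
have w0 : 0 <= w by apply: blocks_weight_ge0; apply: leq_trans (leqW kd).
have := @rh_gap _ _ _ _ _ _ _ hP p b q; rewrite -BhatE -/w.
move=> /(_ kd pk bp qk); rewrite /helpers_bound -BhatE.
rewrite !(cut_term_ge beta0 theta_lt alphaE) //.
rewrite (cut_term_slack_ge beta0 theta_lt alphaE) //.
rewrite alphaE S_INR => le; apply: ler_div_addr1; last by lra.
by apply: Rmult_le_pos => //; apply: pos_INR.
Qed.

Lemma gap_ge_eps0 : (p < k)%N -> (2 <= p)%N -> eps0 k d p beta theta <= gap.
Proof.
move=> pk p2; have pk' := ltnW pk; rewrite /eps0 /=.
have INRb : INR (k - p + 1) = INR k - INR p + 1.
  by rewrite addn1 S_INR minus_INR //; apply/leP.
have INRp : INR p.-1 = INR p - 1 by rewrite -{2}(prednK p0) S_INR; ring.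
have kE : (p.-1 + (k - p + 1) = k)%N.
  by rewrite addn1 addnS -addSn prednK // subnKC.
case: ifPn => [bp|]; last rewrite -leqNgt => bp.
  have cond : (0 < k - p + 1 <= p)%N by rewrite (ltnW bp) addn1.
  have := gap_ge_blocks0 pk cond (q := 1); rewrite mul1n kE leqnn => /(_ isT).
  (* The single block exhausts the [k] collected nodes, leaving [d + 1 - k] beyond it. *)
  have -> : blocks_weight d p.-1 (k - p + 1) 1 = INR d - INR k + 1.
    by rewrite /blocks_weight INRb INRp /=; field.
  by rewrite INRb; have -> : INR k - INR p + 1 - 1 = INR k - INR p by ring.
set q := (_ %/ _)%N; have le : (p.-1 + q * p <= k)%N.
  by rewrite -[leqRHS]kE leq_add2l leq_divM.
have cond : (0 < p <= p)%N by rewrite p0 leqnn.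
have := gap_ge_blocks0 pk cond le => /=.
(* Beyond the [j]-th block lie [d + 2 - p * (j + 1)] nodes; summing over [j] from 1 to [q] gives the
   constant of [eps0]. *)
have -> : blocks_weight d p.-1 p q =
          (INR d - INR p * (INR q + 3) / 2 + 2) * INR q.
  by rewrite /blocks_weight INRp; field.
by [].
Qed.

Lemma gap_ge_eps1 : (p.+2 <= k)%N -> eps1 k d p beta theta <= gap.
Proof.
move=> pk; have pk' : (p <= k)%N by apply: ltnW; apply: ltnW.
have INRb : INR (k - p) = INR k - INR p by rewrite minus_INR //; apply/leP.
rewrite /eps1 /= !addn1.
case: ifPn => [bp|]; last rewrite -leqNgt => bp.
  have cond : (0 < k - p <= p.+1)%N by rewrite subn_gt0 (ltnW pk) ltnW.
  have := gap_ge_blocks1 pk cond (q := 1); rewrite mul1n subnKC // leqnn.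
  move=> /(_ isT); have -> : blocks_weight d p (k - p) 1 = INR d - INR k + 1.
    by rewrite /blocks_weight INRb /=; field.
  by rewrite INRb.
set q := (_ %/ _)%N; have le : (p + q * p.+1 <= k)%N.
  by rewrite -[leqRHS](subnKC pk') leq_add2l leq_divM.
have := gap_ge_blocks1 pk (b := p.+1) (leqnn _) le; rewrite S_INR.
have -> : blocks_weight d p p.+1 q =
          (INR d - (INR p + 1) * (INR q + 3) / 2 + 2) * INR q.
  by rewrite /blocks_weight S_INR; field.
by have -> : INR p + 1 - 2 = INR p - 1 by ring.
Qed.

End Gap.

Theorem theorem1 (F : finFieldType) (n k d B : nat) (alpha beta : R)
    (p : nat) (theta : R) (W : 'I_n -> msg F B -> nat) :
  (k <= d)%N -> (d < n)%N -> (3 <= k)%N ->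
  (0 < alpha)%R -> (0 < beta)%R ->
  (1 <= p)%N -> (p <= k)%N ->
  (0 <= theta)%R -> (theta < beta)%R -> (p = k -> theta = 0%R) ->
  alpha = ((INR d - INR p + 1) * beta - theta)%R ->
  is_ER_code F n k d B alpha beta W ->
  (p = 1%N -> theta <> 0%R ->
     (INR B <= Bhat k d alpha beta - eps1 k d p beta theta)%R) /\
  ((2 <= p)%N -> (p <= k - 2)%N ->
     (INR B <= Bhat k d alpha beta
                - Rmax (eps0 k d p beta theta) (eps1 k d p beta theta))%R) /\
  (p = (k - 1)%N -> (theta < (INR d - INR k + 1) / (INR d - INR k + 2) * beta)%R ->
     (INR B <= Bhat k d alpha beta - eps0 k d p beta theta)%R).
Proof.
move=> kd dn k3 _ beta0 p0 _ theta_ge0 theta_lt _ alphaE code.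
have [h hP] := ER_code_repair_entropy dn beta0 code.
have e0 := gap_ge_eps0 hP kd p0 beta0 theta_ge0 theta_lt alphaE.
have e1 := gap_ge_eps1 hP kd beta0 theta_lt alphaE.
split=> [p1 _|]; first by have := e1; rewrite {1}p1 => /(_ k3); lra.
split=> [p2 pk|pk _].
  have pk2 : (p.+2 <= k)%N.
    by move: pk; rewrite leq_subRL ?add2n // (leq_trans _ k3).
  by have := e0 (ltnW pk2) p2; have := e1 pk2; rewrite /Rmax; case: Rle_dec; lra.
have k1 : (1 <= k)%N by apply: leq_trans k3.
have pk1 : (p < k)%N by rewrite pk ltn_subrL.
have p2 : (2 <= p)%N by rewrite pk leq_subRL.
by have := e0 pk1 p2; lra.
Qed.
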